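(* Let $\Phi\in\mathbb{C}^{q\times q}\langle\langle z_1,\ldots,z_N\rangle\rangle_{\rm rat}$ be a rational formal power series, and let $\alpha=(N;A,B,C,D;\mathbb{C}^\gamma=\bigoplus_{k=1}^N\mathbb{C}^{\gamma_k},\mathbb{C}^q)$ be a minimal GR-realization of $\Phi$. Then $\Phi$ is matrix-selfadjoint on $\mathcal{J}_N$ if and only if the following conditions hold: (a) the matrix $D$ is Hermitian, that is, $D=D^*$; (b) there exists an invertible Hermitian matrix $H={\rm diag}(H_1,\ldots,H_N)$, with $H_k\in\mathbb{C}^{\gamma_k\times\gamma_k}$, $k=1,\ldots,N$, such that $$A^*H+HA=0\quad\text{and}\quad C=iB^*H.$$
   Context: Formal power series. $\mathcal{F}_N$ is the free monoid on generators $g_1,\ldots,g_N$ with empty word $\emptyset$. A formal power series (FPS) in non-commuting indeterminates $z_1,\ldots,z_N$ is $f(z)=\sum_{w\in\mathcal{F}_N}f_wz^w$, where $z^w=z_{i_1}\cdots z_{i_n}$ for $w=g_{i_1}\cdots g_{i_n}$; the indeterminates commute with coefficients and products are by convolution over factorizations of words. A scalar FPS is rational if it is obtained from non-commutative polynomials by finitely many sums, products and inversions (of FPSs with non-zero constant term); a matrix FPS is rational if all its entries are. GR-nodes. A GR-node $\alpha=(N;A,B,C,D;\mathbb{C}^r=\bigoplus_{k=1}^N\mathbb{C}^{r_k},\mathbb{C}^q)$ consists of matrices $A\in\mathbb{C}^{r\times r}$, $B\in\mathbb{C}^{r\times q}$, $C\in\mathbb{C}^{q\times r}$, $D\in\mathbb{C}^{q\times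 q}$, with blocks $A_{ij},B_i,C_j$ along the decomposition of $\mathbb{C}^r$. Its transfer function is the rational FPS $T^{\rm nc}_\alpha(z)=D+C(I_r-\Delta(z)A)^{-1}\Delta(z)B$ with $\Delta(z)={\rm diag}(z_1I_{r_1},\ldots,z_NI_{r_N})$, i.e. the coefficient at $\emptyset$ is $D$ and at $w=g_{j_1}\cdots g_{j_n}$ it is $C_{j_1}A_{j_1j_2}\cdots A_{j_{n-1}j_n}B_{j_n}$. $\alpha$ is a GR-realization of $\Phi$ if $T_\alpha^{\rm nc}=\Phi$; it is minimal if each $r_k$ is the smallest possible among all GR-realizations of $\Phi$. For minimal realizations one writes $\gamma_k$ for $r_k$ and $\gamma=\sum_k\gamma_k$. Evaluation. For $Z=(Z_1,\ldots,Z_N)\in(\mathbb{C}^{n\times n})^N$, $\Phi(Z)$ is obtained by substituting $Z_k$ for $z_k$ in a rational expression for $\Phi$; near $Z=0$ it equals $\sum_w\Phi_w\otimes Z^w$, and it is a $\mathbb{C}^{q\times q}\otimes\mathbb{C}^{n\times n}$-valued rational function of the entries of the $Z_k$, defined (holomorphic) on an open dense set containing a neighbourhood of $0$. Matrix-selfadjointness. Let $\mathbb{H}^{n\times n}$ be the set of Hermitian $n\times n$ matrices and $\mathcal{J}_N=\coprod_{n\in\mathbb{N}}(i\mathbb{H}^{n\times n})^N$. $\Phi$ is matrix-selfadjoint on $\mathcal{J}_N$ if for every $n\in\mathbb{N}$, $\Phi(Z)=\Phi(Z)^*$ at all $Z\in(i\mathbb{H}^{n\times n})^N$ where $\Phi(Z)$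 is defined. *)

(* Defs.v *)
From HB Require Import structures.
From mathcomp Require Import all_boot all_order all_algebra complex.

Set Implicit Arguments.
Unset Strict Implicit.
Unset Printing Implicit Defensive.

Import Order.TTheory GRing.Theory Num.Theory.

Local Open Scope ring_scope.
Local Open Scope sesquilinear_scope.

(* The word g_{i_1} ... g_{i_n} is the sequence [:: i_1; ...; i_n] (generators
   are numbered from 0), and a formal power series is its coefficient family. *)
Definition word (N : nat) := seq 'I_N.

Definition fps (K : Type) (N : nat) := word N -> K.

Section ScalarSeries.
Variables (K : fieldType) (N : nat).

Definition fps_const (c : K) : fps K N := fun w => if w is [::] then c else 0.

Definition fps_var (i : 'I_N) : fps K N := fun w => (w == [:: i])%:R.

Definition fps_add (f g : fps K N) : fps K N := fun w => f w + g w.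

(* w ranges over its (size w).+1 factorizations w = (take k w) (drop k w). *)
Definition fps_mul (f g : fps K N) : fps K N :=
  fun w => \sum_(k < (size w).+1) f (take k w) * g (drop k w).

Inductive ratexpr : Type :=
  | RConst of K
  | RVar of 'I_N
  | RAdd of ratexpr & ratexpr
  | RMul of ratexpr & ratexpr
  | RInv of ratexpr.

(* [denotes e f]: the expression e, in which only series with non-zero constant
   term are inverted, is an expression for the series f. *)
Fixpoint denotes (e : ratexpr) (f : fps K N) : Prop :=
  match e with
  | RConst c => f =1 fps_const c
  | RVar i => f =1 fps_var i
  | RAdd e1 e2 => exists f1 f2 : fps K N,
      [/\ denotes e1 f1, denotes e2 f2 & f =1 fps_add f1 f2]
  | RMul e1 e2 => exists f1 f2 : fps K N,
      [/\ denotes e1 f1, denotes e2 f2 & f =1 fps_mul f1 f2]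
  | RInv e1 => exists f1 : fps K N,
      [/\ denotes e1 f1, f1 [::] != 0,
          fps_mul f1 f =1 fps_const 1 & fps_mul f f1 =1 fps_const 1]
  end.

Section Substitution.
Variables (n : nat) (Z : 'I_N -> 'M[K]_n).

(* Only meaningful under [subst_defined], since invmx is the identity on
   singular matrices. *)
Fixpoint subst (e : ratexpr) : 'M[K]_n :=
  match e with
  | RConst c => c%:M
  | RVar i => Z i
  | RAdd e1 e2 => subst e1 + subst e2
  | RMul e1 e2 => subst e1 *m subst e2
  | RInv e1 => invmx (subst e1)
  end.

Fixpoint subst_defined (e : ratexpr) : bool :=
  match e with
  | RConst _ | RVar _ => true
  | RAdd e1 e2 | RMul e1 e2 => subst_defined e1 && subst_defined e2
  | RInv e1 => subst_defined e1 && (subst e1 \in unitmx)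
  end.

End Substitution.
End ScalarSeries.

Section MatrixSeries.
Variables (K : fieldType) (N q : nat).

Definition expr_for (Phi : fps 'M[K]_q N) (e : 'I_q -> 'I_q -> ratexpr K N) :=
  forall i j, denotes (e i j) (fun w => Phi w i j).

Definition fps_rational (Phi : fps 'M[K]_q N) : Prop :=
  forall i j, exists e, denotes e (fun w => Phi w i j).

(* [value_at Phi Z V]: Phi(Z) is defined and equal to V.  The domain of Phi is
   the union of the domains of the rational expressions for Phi, and an element
   of K^{q x q} (x) K^{n x n} is written as a q x q block matrix with n x n
   blocks, so that block (i, j) of V is Phi_ij(Z). *)
Definition value_at (Phi : fps 'M[K]_q N) (n : nat) (Z : 'I_N -> 'M[K]_n)
    (V : 'M[K]_(\sum_(i < q) n)) : Prop :=
  exists e : 'I_q -> 'I_q -> ratexpr K N,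
    [/\ expr_for Phi e,
        forall i j, subst_defined Z (e i j) &
        V = mxblock (fun i j => subst Z (e i j))].

Record gr_node := GRNode {
  gr_dim : 'I_N -> nat;
  gr_A : 'M[K]_(\sum_k gr_dim k);
  gr_B : 'M[K]_(\sum_k gr_dim k, q);
  gr_C : 'M[K]_(q, \sum_k gr_dim k);
  gr_D : 'M[K]_q }.

(* gr_chain alpha j_1 [:: j_2; ...; j_n]
     = A_{j_1 j_2} ... A_{j_{n-1} j_n} B_{j_n} *)
Fixpoint gr_chain (alpha : gr_node) (j : 'I_N) (w : word N) :
    'M[K]_(gr_dim alpha j, q) :=
  if w is k :: w' then submxblock (gr_A alpha) j k *m gr_chain alpha k w'
  else submxcol (gr_B alpha) j.

(* The coefficients of D + C (I - Delta(z) A)^-1 Delta(z) B. *)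
Definition gr_transfer (alpha : gr_node) : fps 'M[K]_q N :=
  fun w => if w is j :: w' then submxrow (gr_C alpha) j *m gr_chain alpha j w'
           else gr_D alpha.

Definition gr_realization (alpha : gr_node) (Phi : fps 'M[K]_q N) : Prop :=
  gr_transfer alpha =1 Phi.

Definition gr_minimal (alpha : gr_node) (Phi : fps 'M[K]_q N) : Prop :=
  gr_realization alpha Phi /\
  forall beta : gr_node, gr_realization beta Phi ->
    forall k, (gr_dim alpha k <= gr_dim beta k)%N.

End MatrixSeries.

Definition iherm (C : numClosedFieldType) (n : nat) (X : 'M[C]_n) : Prop :=
  exists2 Y : 'M[C]_n, Y \is hermsymmx & X = 'i *: Y.

Definition matrix_selfadjoint (C : numClosedFieldType) (N q : nat)
    (Phi : fps 'M[C]_q N) : Prop :=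
  forall (n : nat) (Z : 'I_N -> 'M[C]_n) (V : 'M[C]_(\sum_(i < q) n)),
    (0 < n)%N -> (forall k, iherm (Z k)) -> value_at Phi Z V -> V = V^t*.

(* Main.v *)
(* A value Phi(Z) is determined by the series: along the line t Z a rational
   expression is a matrix of rational functions of t whose Taylor coefficients at
   t = 0 are the homogeneous components of Phi at Z.  Hence Phi is matrix-selfadjoint
   if and only if Phi_w = (-1)^|w| (Phi_{rev w})^* for every word w; for the direct
   implication, a single word is isolated by evaluating at skew-symmetric
   tridiagonal matrices.

   The coefficient symmetry says that the adjoint node (-A^*, C^*, -B^*, D^* )
   realizes Phi as well.  If alpha is minimal, both nodes are minimal, hence
   controllable, and a unique block diagonal S satisfies S A = -A^* S, S B = C^* and
   C = -B^* S.  As -S^* satisfies the same equations, S is skew-Hermitian and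
   H = i S is the required matrix. *)
Require Import Defs.
From mathcomp Require Import all_boot all_order all_algebra complex reals boolp.

Import GRing.Theory Num.Theory.
Local Open Scope ring_scope.
Local Open Scope sesquilinear_scope.

Set Implicit Arguments.
Unset Strict Implicit.
Unset Printing Implicit Defensive.

(** * Series and rational expressions restricted to a line [t Z] *)

Section Truncation.
Variables (K : fieldType) (N n : nat).
Implicit Types (Z : 'I_N -> 'M[K]_n) (f g : fps K N) (e : ratexpr K N).

Definition eqmx_modX m p r (A B : 'M[{poly K}]_(p, r)) :=
  forall i j k, (k < m)%N -> (A i j)`_k = (B i j)`_k.

Lemma eqmx_modX_sym m p r (A B : 'M[{poly K}]_(p, r)) :
  eqmx_modX m A B -> eqmx_modX m B A.
Proof. by move=> h i j k lkm; rewrite h. Qed.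

Lemma eqmx_modX_trans m p r (A B D : 'M[{poly K}]_(p, r)) :
  eqmx_modX m A B -> eqmx_modX m B D -> eqmx_modX m A D.
Proof. by move=> h1 h2 i j k lkm; rewrite h1 ?h2. Qed.

Lemma eqmx_modXD m p r (A A' B B' : 'M[{poly K}]_(p, r)) :
  eqmx_modX m A A' -> eqmx_modX m B B' -> eqmx_modX m (A + B) (A' + B').
Proof. by move=> h1 h2 i j k lkm; rewrite !mxE !coefD h1 ?h2. Qed.

Lemma eqmx_modX_sum m p r (I : finType) (A B : I -> 'M[{poly K}]_(p, r)) :
  (forall i, eqmx_modX m (A i) (B i)) -> eqmx_modX m (\sum_i A i) (\sum_i B i).
Proof.
move=> h i j k lkm; rewrite !summxE !coef_sum.
by apply: eq_bigr => l _; apply: h.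
Qed.

Lemma eqmx_modXM m p r s (A A' : 'M[{poly K}]_(p, r)) (B B' : 'M_(r, s)) :
  eqmx_modX m A A' -> eqmx_modX m B B' -> eqmx_modX m (A *m B) (A' *m B').
Proof.
move=> h1 h2 i j k lkm; rewrite !mxE !coef_sum; apply: eq_bigr => l _.
rewrite !coefM; apply: eq_bigr => a _; rewrite h1 ?h2 //.
  by apply: leq_ltn_trans lkm; apply: leq_subr.
by apply: leq_trans lkm; rewrite ltnS -ltnS ltn_ord.
Qed.

Lemma eqmx_modXZ m p r a (A B : 'M[{poly K}]_(p, r)) :
  eqmx_modX m A B -> eqmx_modX m (a *: A) (a *: B).
Proof. by move=> h; rewrite -!mul_scalar_mx; apply: eqmx_modXM. Qed.

Lemma eqmx_modX_shift m p r (A B : 'M[{poly K}]_(p, r)) :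
  eqmx_modX m A B -> eqmx_modX m.+1 ('X *: A) ('X *: B).
Proof.
by move=> h i j [|k] lkm; rewrite !mxE !coefXM //=; apply: h.
Qed.

Lemma eqmx_modX_eq p r (A B : 'M[{poly K}]_(p, r)) :
  (forall m, eqmx_modX m A B) -> A = B.
Proof. by move=> h; apply/matrixP=> i j; apply/polyP=> k; apply: (h k.+1). Qed.

Definition fps_shift (i : 'I_N) f : fps K N := fun w => f (i :: w).

(* The terms of degree less than m in t of f(t Z_1, ..., t Z_N). *)
Fixpoint line_trunc Z m f : 'M[{poly K}]_n :=
  if m is m'.+1 then
    (f [::])%:P%:M
      + 'X *: \sum_i map_mx polyC (Z i) *m line_trunc Z m' (fps_shift i f)
  else 0.

Lemma eq_line_trunc Z m f g : f =1 g -> line_trunc Z m f = line_trunc Z m g.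
Proof.
elim: m f g => //= m IHm f g efg; rewrite efg; congr (_ + 'X *: _).
by apply: eq_bigr => i _; rewrite (IHm _ (fps_shift i g)) // => w; apply: efg.
Qed.

Lemma line_truncZD Z m a f g :
  line_trunc Z m (fun w => a * f w + g w)
    = a%:P *: line_trunc Z m f + line_trunc Z m g.
Proof.
elim: m f g => /= [|m IHm] f g; first by rewrite scaler0 addr0.
rewrite polyCD polyCM raddfD /= -scale_scalar_mx scalerDr addrACA.
congr (_ + _); rewrite scalerA mulrC -scalerA -scalerDr; congr ('X *: _).
rewrite scaler_sumr -big_split; apply: eq_bigr => i _ /=.
by rewrite (IHm (fps_shift i f) (fps_shift i g)) mulmxDr scalemxAr.
Qed.

Lemma line_trunc0 Z m : line_trunc Z m (fun=> 0) = 0.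
Proof.
elim: m => //= m IHm; rewrite big1 ?scaler0 ?addr0 ?raddf0 // => i _.
by rewrite (_ : line_trunc _ _ _ = 0) ?mulmx0.
Qed.

Lemma line_trunc_const Z m c :
  eqmx_modX m (line_trunc Z m (@fps_const K N c)) c%:P%:M.
Proof.
case: m => [|m] i j k //= _; rewrite big1 ?scaler0 ?addr0 // => l _.
by rewrite (eq_line_trunc _ _ (g := fun=> 0)) // line_trunc0 mulmx0.
Qed.

Lemma line_trunc_var Z m i :
  eqmx_modX m (line_trunc Z m (fps_var K i)) ('X *: map_mx polyC (Z i)).
Proof.
case: m => [|m] //=; rewrite raddf0 add0r.
apply: eqmx_modX_shift.
rewrite [X in eqmx_modX _ _ X](_ : _ = \sum_j map_mx polyC (Z j) *m (i == j)%:R%:P%:M).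
  apply: eqmx_modX_sum => j; apply: eqmx_modXM => //.
  rewrite (eq_line_trunc _ _ (g := @fps_const K N (i == j)%:R)).
    exact: line_trunc_const.
  by case=> [|a w]; rewrite /fps_shift /fps_var eqseq_cons ?andbT ?andbF // eq_sym.
rewrite (bigD1 i) //= eqxx mulmx1 big1 ?addr0 // => j ji.
by rewrite [i == j]eq_sym (negPf ji) !raddf0.
Qed.

Lemma fps_shift_mul i f g w :
  fps_shift i (fps_mul f g) w
    = f [::] * fps_shift i g w + fps_mul (fps_shift i f) g w.
Proof. by rewrite /fps_shift /fps_mul big_ord_recl. Qed.

(** The product of two truncations has extra terms of degree at least [m], hence only a congruence.
    Induction on [m] peels off the first letter by the Leibniz-type rule [fps_shift_mul]. *)
Lemma line_trunc_mul Z m f g :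
  eqmx_modX m (line_trunc Z m (fps_mul f g))
              (line_trunc Z m f *m line_trunc Z m g).
Proof.
elim: m f g => // m IHm f g.
pose W i := map_mx polyC (Z i).
set G := line_trunc Z m.+1 g.
have eG : G = (g [::])%:P%:M
    + 'X *: \sum_i W i *m line_trunc Z m (fps_shift i g) by [].
have gG : eqmx_modX m (line_trunc Z m g) G.
  rewrite /G; elim: m {IHm G eG} g => // m IHm g.
  by apply: eqmx_modXD => //; apply: eqmx_modX_shift;
     apply: eqmx_modX_sum => i; apply: eqmx_modXM.
rewrite /= mulmxDl mul_scalar_mx {1}eG scalerDr -addrA.
rewrite /fps_mul /= big_ord_recl big_ord0 addr0 polyCM -scale_scalar_mx.
apply: eqmx_modXD => //.
rewrite scalerA mulrC -scalerA -scalemxAl -scalerDr.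
apply: eqmx_modX_shift; rewrite mulmx_suml scaler_sumr -big_split.
apply: eqmx_modX_sum => i /=.
rewrite (eq_line_trunc _ _ (fps_shift_mul i f g)) line_truncZD mulmxDr.
rewrite -scalemxAr -mulmxA; apply: eqmx_modXD => //; apply: eqmx_modXM => //.
by apply: eqmx_modX_trans (IHm _ _) _; apply: eqmx_modXM.
Qed.

Lemma line_trunc1 Z m f i j :
  (line_trunc Z m.+1 f i j)`_0 = (f [::])%:M i j.
Proof.
rewrite !mxE /= coefD coefXM /= addr0.
by case: eqP => _; rewrite ?mulr1n ?mulr0n ?coefC.
Qed.

(* Restricted to the line t Z, an expression is the rational function P / d of t. *)
Lemma ratexpr_line Z e f : denotes e f ->
  exists (d : {poly K}) (P : 'M[{poly K}]_n),
    [/\ d.[0] != 0,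
        forall m, eqmx_modX m (d *: line_trunc Z m f) P,
        forall t, subst_defined (fun i => t *: Z i) e = (d.[t] != 0) &
        forall t, d.[t] != 0 ->
          d.[t] *: subst (fun i => t *: Z i) e = map_mx (horner_eval t) P].
Proof.
elim: e f => [c|i|e1 IH1 e2 IH2|e1 IH1 e2 IH2|e IH] f /=.
- move=> ef; exists 1, c%:P%:M; split=> [|m|t|t _].
  + by rewrite hornerC oner_eq0.
  + by rewrite scale1r (eq_line_trunc _ _ ef); apply: line_trunc_const.
  + by rewrite hornerC oner_eq0.
  + by rewrite hornerC scale1r map_scalar_mx /= /horner_eval hornerC.
- move=> ef; exists 1, ('X *: map_mx polyC (Z i)); split=> [|m|t|t _].
  + by rewrite hornerC oner_eq0.
  + by rewrite scale1r (eq_line_trunc _ _ ef); apply: line_trunc_var.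
  + by rewrite hornerC oner_eq0.
  + rewrite hornerC scale1r; apply/matrixP=> a b.
    by rewrite !mxE /horner_eval hornerM hornerX hornerC.
- case=> f1 [f2 [/IH1 [d1 [P1 [z1 m1 s1 v1]]] /IH2 [d2 [P2 [z2 m2 s2 v2]]] ef]].
  exists (d1 * d2), (d2 *: P1 + d1 *: P2); split=> [|m|t|t].
  + by rewrite hornerM mulf_neq0.
  + rewrite (eq_line_trunc _ _ (g := fun w => 1 * f1 w + f2 w)); last first.
      by move=> w; rewrite mul1r ef.
    rewrite line_truncZD scale1r scalerDr {1}mulrC -!scalerA.
    by apply: eqmx_modXD; apply: eqmx_modXZ.
  + by rewrite s1 s2 hornerM mulf_eq0 negb_or.
  + rewrite hornerM mulf_eq0 negb_or => /andP[h1 h2].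
    rewrite scalerDr {1}mulrC -!scalerA v1 // v2 //.
    by apply/matrixP=> a b; rewrite !mxE /horner_eval hornerD !hornerM.
- case=> f1 [f2 [/IH1 [d1 [P1 [z1 m1 s1 v1]]] /IH2 [d2 [P2 [z2 m2 s2 v2]]] ef]].
  exists (d1 * d2), (P1 *m P2); split=> [|m|t|t].
  + by rewrite hornerM mulf_neq0.
  + rewrite (eq_line_trunc _ _ ef).
    apply: eqmx_modX_trans (eqmx_modXZ _ (line_trunc_mul _ _ _)) _.
    by rewrite -scalerA scalemxAr scalemxAl; apply: eqmx_modXM.
  + by rewrite s1 s2 hornerM mulf_eq0 negb_or.
  + rewrite hornerM mulf_eq0 negb_or => /andP[h1 h2].
    by rewrite -scalerA scalemxAr scalemxAl v1 // v2 // map_mxM.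
case=> f1 [/IH [d [P [z0 m0 s0 v0]]] f1nz ef _].
have dv t : d.[t] != 0 ->
    (\det P).[t] = d.[t] ^+ n * \det (subst (fun i => t *: Z i) e).
  by move=> /v0 vt; rewrite -detZ vt det_map_mx.
(* From [F = P / d] comes [F^-1 = d adj P / det P]; the further factor [d] above and below makes the
   denominator vanish wherever the inner expression is undefined. *)
exists (d * \det P), (d ^+ 2 *: \adj P); split=> [|m|t|t].
- rewrite hornerM mulf_neq0 // -[X in X != 0]/(horner_eval 0 _) -det_map_mx.
  rewrite (_ : map_mx _ _ = (d.[0] * f1 [::])%:M); last first.
    apply/matrixP=> a b; rewrite !mxE /= /horner_eval !horner_coef0.
    rewrite -(m0 1%N a b 0%N) // mxE coef0M line_trunc1 mxE.
    by rewrite mulrnAr.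
  by rewrite det_scalar expf_neq0 // mulf_neq0.
- have h : eqmx_modX m (line_trunc Z m f1 *m line_trunc Z m f) 1%:M.
    apply: eqmx_modX_trans (eqmx_modX_sym (line_trunc_mul _ _ _)) _.
    by rewrite (eq_line_trunc _ _ ef); apply: line_trunc_const.
  rewrite -scalerA -[\det P *: _]mul_scalar_mx -mul_adj_mx -mulmxA expr2 -scalerA.
  apply: eqmx_modXZ; rewrite -[d *: \adj P]mulmx1 -scalemxAl scalemxAr.
  apply: eqmx_modXM => //.
  apply: eqmx_modX_trans (eqmx_modXZ d h).
  by rewrite scalemxAl; apply: eqmx_modXM => //; apply: eqmx_modX_sym.
- rewrite s0 hornerM mulf_eq0 negb_or; case: eqVneq => //= dt.
  by rewrite dv // mulf_eq0 negb_or expf_neq0 //= unitmxE unitfE.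
rewrite hornerM mulf_eq0 negb_or => /andP[dt Pt].
have mapdet: (\det P).[t] = \det (map_mx (horner_eval t) P) by rewrite det_map_mx.
have U : map_mx (horner_eval t) P \in unitmx by rewrite unitmxE unitfE -mapdet.
have -> : subst (fun i => t *: Z i) e = d.[t]^-1 *: map_mx (horner_eval t) P.
  by rewrite -v0 // scalerA mulVf // scale1r.
rewrite invmxZ ?unitmxZ ?unitfE ?invr_eq0 // invrK /invmx U scalerA.
rewrite mapdet.
rewrite [RHS](_ : _ = d.[t] ^+ 2 *: map_mx (horner_eval t) (\adj P)); last first.
  by apply/matrixP=> a b; rewrite !mxE /horner_eval hornerM horner_exp.
rewrite map_mx_adj !scalerA; congr (_ *: _).
by rewrite -mapdet mulrACA mulfV // mulr1 expr2.
Qed.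

(** The fractions [P1 / d1] and [P2 / d2] have the same expansion at 0, so [d2 *: P1] and [d1 *: P2]
    agree modulo every power of ['X]; evaluation at [t = 1] then reaches [Z], however far from 0. *)
Lemma line_evaluations_agree Z e1 e2 f : denotes e1 f -> denotes e2 f ->
  subst_defined Z e1 -> subst_defined Z e2 -> subst Z e1 = subst Z e2.
Proof.
move=> /(ratexpr_line Z) [d1 [P1 [_ m1 s1 v1]]].
move=> /(ratexpr_line Z) [d2 [P2 [_ m2 s2 v2]]].
have -> : Z = (fun i => 1 *: Z i) by apply/funext=> i; rewrite scale1r.
rewrite s1 s2 => h1 h2.
have E : d2 *: P1 = d1 *: P2.
  apply: eqmx_modX_eq => m.
  apply: eqmx_modX_trans (eqmx_modXZ _ (eqmx_modX_sym (m1 m))) _.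
  apply: eqmx_modX_trans (eqmx_modXZ _ (m2 m)).
  by rewrite !scalerA mulrC.
apply: (scalerI (mulf_neq0 h1 h2)); rewrite {1}mulrC -!scalerA v1 // v2 //.
apply/matrixP=> a b; have /matrixP/(_ a b)/(congr1 (horner_eval 1)) := E.
by rewrite !mxE /horner_eval !hornerM.
Qed.

(** Identity principle on a line. The test points are natural numbers because real multiples keep a
    tuple skew-Hermitian; [r] excludes finitely many of them. *)
Lemma line_trunc_agree Z (r : {poly K}) e1 e2 f g :
  denotes e1 f -> denotes e2 g ->
  (forall k l : nat, (k%:R == l%:R :> K) = (k == l)) -> r != 0 ->
  (forall l : nat, r.[l%:R] != 0 ->
     [/\ subst_defined (fun i => l%:R *: Z i) e1,
         subst_defined (fun i => l%:R *: Z i) e2 &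
         subst (fun i => l%:R *: Z i) e1 = subst (fun i => l%:R *: Z i) e2]) ->
  forall m, eqmx_modX m (line_trunc Z m f) (line_trunc Z m g).
Proof.
move=> /(ratexpr_line Z) [d1 [P1 [z1 m1 s1 v1]]].
move=> /(ratexpr_line Z) [d2 [P2 [z2 m2 s2 v2]]] char0 rnz agree.
have E : d2 *: P1 = d1 *: P2.
  apply/matrixP=> a b; apply/eqP; rewrite -subr_eq0.
  set p := (X in X == 0).
  suff : r * p == 0 by rewrite mulf_eq0 (negPf rnz).
  apply: contraT => nz; set s := r * p in nz.
  have := max_poly_roots (rs := [seq l%:R | l <- iota 0 (size s)]) nz.
  rewrite size_map size_iota ltnn; apply.
    apply/allP=> _ /mapP[l _ ->]; rewrite /root /s hornerM mulf_eq0.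
    have [//|/agree] := eqVneq r.[l%:R] 0; rewrite s1 s2 /p => -[h1 h2 El] /=.
    rewrite !mxE hornerD hornerN subr_eq0; apply/eqP.
    have := congr1 (fun M : 'M_n => M a b) (v1 _ h1).
    have := congr1 (fun M : 'M_n => M a b) (v2 _ h2).
    rewrite !mxE /horner_eval !hornerM => <- <-.
    by rewrite El mulrCA.
  by rewrite map_inj_uniq ?iota_uniq // => k l /eqP; rewrite char0 => /eqP.
move=> m; have dd : eqmx_modX m ((d1 * d2) *: line_trunc Z m f)
                                ((d1 * d2) *: line_trunc Z m g).
  rewrite -[in X in eqmx_modX _ _ X]scalerA {1}mulrC -scalerA.
  apply: eqmx_modX_trans (eqmx_modXZ _ (m1 m)) _.
  by rewrite E; apply: eqmx_modXZ; apply: eqmx_modX_sym.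
(* The factor [d1 * d2] is cancelled degree by degree, its constant term being non-zero. *)
move=> i j; elim/ltn_ind => k IHk lkm; have := dd i j k lkm.
rewrite !mxE !coefM !big_ord_recl !subn0 /=.
have d0 : (d1 * d2)`_0 != 0 by rewrite -horner_coef0 hornerM mulf_neq0.
rewrite (eq_bigr (fun l : 'I_k => (d1 * d2)`_(bump 0 l) *
  (line_trunc Z m g i j)`_(k - bump 0 l))); last first.
  move=> l _; rewrite IHk // ?/bump ?leq0n /= ?add1n.
    by rewrite ltn_subrL /= (leq_ltn_trans (leq0n l)).
  by apply: leq_ltn_trans lkm; apply: leq_subr.
by move/addIr/(mulfI d0).
Qed.

Lemma ratexpr_line_defined Z (I : finType) (e : I -> ratexpr K N)
    (f : I -> fps K N) : (forall i, denotes (e i) (f i)) ->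
  exists2 r : {poly K}, r != 0 &
    forall t i, r.[t] != 0 -> subst_defined (fun l => t *: Z l) (e i).
Proof.
move=> de; have /fin_all_exists[d hd] i : exists d : {poly K}, d.[0] != 0 /\
    forall t, subst_defined (fun l => t *: Z l) (e i) = (d.[t] != 0).
  by have [d [P [d0 _ sd _]]] := ratexpr_line Z (de i); exists d.
exists (\prod_i d i) => [|t i].
  apply/prodf_neq0 => i _; have [d0 _] := hd i.
  by apply: contra_neq d0 => ->; rewrite horner0.
have [_ ->] := hd i; rewrite (bigD1 i) //= hornerM.
by rewrite mulf_eq0 negb_or => /andP[].
Qed.

End Truncation.

(** * Conjugate transposes and skew-Hermitian matrices *)

Section ConjTranspose.
Variable C : numClosedFieldType.

Lemma ctmxK m n (A : 'M[C]_(m, n)) : A^t*^t* = A.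
Proof. by apply/matrixP=> i j; rewrite !mxE conjCK. Qed.

Lemma ctmxM m n p (A : 'M[C]_(m, n)) (B : 'M_(n, p)) :
  (A *m B)^t* = B^t* *m A^t*.
Proof. by rewrite trmx_mul map_mxM. Qed.

Lemma ctmxZ m n a (A : 'M[C]_(m, n)) : (a *: A)^t* = a^* *: A^t*.
Proof. by apply/matrixP=> i j; rewrite !mxE rmorphM. Qed.

Lemma ctmxN m n (A : 'M[C]_(m, n)) : (- A)^t* = - A^t*.
Proof. by rewrite !raddfN. Qed.

Lemma ctmxD m n (A B : 'M[C]_(m, n)) : (A + B)^t* = A^t* + B^t*.
Proof. by rewrite !raddfD. Qed.

Lemma ctmx0 m n : (0 : 'M[C]_(m, n))^t* = 0.
Proof. by rewrite !raddf0. Qed.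

Lemma ctmx_eq0 m n (A : 'M[C]_(m, n)) : A^t* = 0 -> A = 0.
Proof. by move=> A0; rewrite -[A]ctmxK A0 ctmx0. Qed.

Lemma ctmx_mxblock p q (p_ : 'I_p -> nat) (q_ : 'I_q -> nat)
    (B : forall i j, 'M[C]_(p_ i, q_ j)) :
  (mxblock B)^t* = mxblock (fun i j => (B j i)^t*).
Proof. by rewrite tr_mxblock; apply/matrixP=> i j; rewrite !mxE. Qed.

Lemma ihermP n (Z : 'M[C]_n) : iherm Z <-> Z^t* = - Z.
Proof.
split=> [[Y /is_hermitianmxP]|Zs].
  by rewrite expr0 scale1r => Yh ->; rewrite ctmxZ -Yh conjCi scaleNr.
exists (- 'i *: Z); last by rewrite scalerA mulrN -expr2 sqrCi opprK scale1r.
apply/is_hermitianmxP; rewrite expr0 scale1r ctmxZ Zs rmorphN /= conjCi opprK.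
by rewrite scalerN scaleNr.
Qed.

End ConjTranspose.

(** * Adjoints of series and of rational expressions *)

Section Adjoint.
Variables (C : numClosedFieldType) (N : nat).
Implicit Types (f g : fps C N) (e : ratexpr C N).

(* The series w |-> (-1)^|w| (Phi_{rev w})^*, whose value at a tuple of
   skew-Hermitian matrices is the adjoint of the value of Phi. *)
Definition fps_adj f : fps C N := fun w => (-1) ^+ size w * (f (rev w))^*.

Fixpoint ratexpr_adj e : ratexpr C N :=
  match e with
  | RConst c => RConst N c^*
  | RVar i => RMul (RConst N (-1)) (RVar C i)
  | RAdd e1 e2 => RAdd (ratexpr_adj e1) (ratexpr_adj e2)
  | RMul e1 e2 => RMul (ratexpr_adj e2) (ratexpr_adj e1)
  | RInv e1 => RInv (ratexpr_adj e1)
  end.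

Lemma fps_mul_constl c f : fps_mul (fps_const c) f =1 (fun w => c * f w).
Proof.
move=> w; rewrite /fps_mul big_ord_recl take0 drop0 big1 ?addr0 // => i _.
by case: w i => [[]|l w i] //; rewrite mul0r.
Qed.

Lemma fps_adj_const c : fps_adj (fps_const c) =1 fps_const c^*.
Proof.
case=> [|l w]; first by rewrite /fps_adj /= expr0 mul1r.
rewrite /fps_adj rev_cons -cats1 /=; case: (rev w) => [|? ?] /=;
by rewrite rmorph0 mulr0.
Qed.

Lemma fps_adj_mul f g :
  fps_adj (fps_mul f g) =1 fps_mul (fps_adj g) (fps_adj f).
Proof.
move=> w; rewrite /fps_adj /fps_mul rmorph_sum mulr_sumr size_rev.
rewrite (reindex_inj rev_ord_inj) /=; apply: eq_bigr => k _.
have lek : (k <= size w)%N by rewrite -ltnS.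
rewrite subSS rmorphM take_rev drop_rev subKn // size_take_min size_drop.
rewrite (minn_idPl lek) mulrACA -exprD subnKC //; congr (_ * _).
exact: mulrC.
Qed.

(** [fps_adj] is conjugate-linear, reverses products and negates the variables; under it the two
    inverse identities required for [RInv] exchange roles. *)
Lemma denotes_adj e f : denotes e f -> denotes (ratexpr_adj e) (fps_adj f).
Proof.
elim: e f => [c|i|e1 IH1 e2 IH2|e1 IH1 e2 IH2|e IH] f /=.
- by move=> /funext->; apply: fps_adj_const.
- move=> /funext->; exists (fps_const (-1)), (fps_var C i); split=> // w.
  rewrite fps_mul_constl /fps_adj /fps_var.
  rewrite -[in X in X^*](revK [:: i]) (can_eq revK) (_ : rev _ = [:: i]) //.
  by case: eqP => [->|_]; rewrite ?rmorph1 ?rmorph0 ?mulr0 ?expr1.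
- case=> f1 [f2 [/IH1 h1 /IH2 h2 /funext->]].
  exists (fps_adj f1), (fps_adj f2); split=> // w.
  by rewrite /fps_adj /fps_add rmorphD mulrDr.
- case=> f1 [f2 [/IH1 h1 /IH2 h2 /funext->]].
  exists (fps_adj f2), (fps_adj f1); split=> // w.
  exact: fps_adj_mul.
case=> f1 [/IH h f0 /funext fr /funext fl]; exists (fps_adj f1); split=> // [|w|w].
- by rewrite /fps_adj mulf_neq0 ?expf_neq0 ?oppr_eq0 ?oner_eq0 ?conjC_eq0.
- by rewrite -fps_adj_mul fl fps_adj_const rmorph1.
- by rewrite -fps_adj_mul fr fps_adj_const rmorph1.
Qed.

Lemma subst_adj n (Z : 'I_N -> 'M[C]_n) : (forall i, (Z i)^t* = - Z i) ->
  forall e, subst Z (ratexpr_adj e) = (subst Z e)^t* /\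
            subst_defined Z (ratexpr_adj e) = subst_defined Z e.
Proof.
move=> Zs; elim=> [c|i|e1 [s1 d1] e2 [s2 d2]|e1 [s1 d1] e2 [s2 d2]|e [s d]] /=.
- by rewrite tr_scalar_mx map_scalar_mx.
- by rewrite mul_scalar_mx scaleN1r Zs.
- by rewrite s1 s2 d1 d2 ctmxD.
- by rewrite s1 s2 d1 d2 ctmxM andbC.
- by rewrite s d map_unitmx unitmx_tr trmx_inv map_invmx.
Qed.

(** * Matrix-selfadjointness as a symmetry of the coefficients *)

Section Selfadjoint.
Variables (q : nat) (Phi : fps 'M[C]_q N).

Definition fps_mxadj (Psi : fps 'M[C]_q N) : fps 'M[C]_q N :=
  fun w => (-1) ^+ size w *: (Psi (rev w))^t*.

Lemma fps_mxadjE Psi i j :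
  (fun w => fps_mxadj Psi w i j) = fps_adj (fun w => Psi w j i).
Proof. by apply/funext=> w; rewrite !mxE. Qed.

(** The adjoint of an expression for entry [(j, i)] is a second expression for entry [(i, j)], and
    two expressions for one series agree wherever both are defined. *)
Lemma matrix_selfadjoint_of_coefs : Phi = fps_mxadj Phi -> matrix_selfadjoint Phi.
Proof.
move=> PhiE n Z V _ /(_ _)/ihermP Zs [e [de defe ->]].
rewrite ctmx_mxblock; apply/eq_mxblockP=> i j.
have [<- sd] := subst_adj Zs (e j i).
apply: line_evaluations_agree (de i j) _ _ _ => //; last by rewrite sd.
by rewrite PhiE fps_mxadjE; apply: denotes_adj.
Qed.

(* Along a path of length |w| from the first to the last index, the only
   monomial contributing to the corner entry is z^w itself. *)
Definition path_mx (w : word N) (l : 'I_N) : 'M[C]_((size w).+1) :=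
  \matrix_(a, b) (((b == a.+1 :> nat) && (ohead (drop a w) == Some l))%:R
                - ((a == b.+1 :> nat) && (ohead (drop b w) == Some l))%:R).

Lemma path_mx_skew w l : (path_mx w l)^t* = - path_mx w l.
Proof.
by apply/matrixP=> a b; rewrite !mxE rmorphB !rmorph_nat opprB.
Qed.

(** The coefficient sums over walks of [j] steps from [a] to the last vertex. As [a + j <= size w],
    only the walk that always moves forward can arrive, and it spells [drop a w]. *)
Lemma path_mx_coef w m f (a : 'I_((size w).+1)) j : (j < m)%N -> (a + j <= size w)%N ->
  (line_trunc (path_mx w) m f a ord_max)`_j
    = if (a + j == size w)%N then f (drop a w) else 0.
Proof.
elim: m f a j => // m IHm f a [_ _|j].
  rewrite line_trunc1 mxE addn0 -val_eqE /=.
  by case: eqP => [->|_]; rewrite ?mulr1n ?mulr0n ?drop_size.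
rewrite ltnS => ltjm leaj; rewrite !mxE coefD coefXM /= summxE coef_sum.
rewrite coefMn coefC /= mul0rn add0r.
(* Contribution of a first step from [a] to [b]: a forward step reads the next letter of [w], while
   a backward step leaves [b + j < size w], too few steps to arrive. *)
have term l b : (map_mx polyC (path_mx w l) a b
      * line_trunc (path_mx w) m (fps_shift l f) b ord_max)`_j
    = if [&& b == a.+1 :> nat, ohead (drop a w) == Some l & a + j.+1 == size w]%N
      then f (l :: drop b w) else 0.
  rewrite mxE coefCM mxE; case: (eqVneq (b : nat) a.+1) => [eb|nb] /=.
    rewrite eb (_ : (_ == a.+2 :> nat) = false) ?subr0; last first.
      by rewrite ltn_eqF.
    case: eqP => [hd|_]; last by rewrite mul0r.
    by rewrite mul1r IHm ?eb ?addSnnS //; case: eqP.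
  rewrite sub0r; case: (eqVneq (a : nat) b.+1) => [ea|na] /=; last first.
    by rewrite oppr0 mul0r.
  have lt : (b + j < size w)%N.
    by apply: leq_trans leaj; rewrite ea addSnnS !addnS ltnS leqnSn.
  by rewrite IHm ?(ltnW lt) // ltn_eqF // mulr0.
under eq_bigr => l _.
  rewrite mxE coef_sum; under eq_bigr do rewrite term.
  over.
case: eqP => [e|_]; last first.
  by rewrite big1 // => l _; rewrite big1 // => b _; rewrite !andbF.
have lta : (a < size w)%N by apply: leq_trans leaj; rewrite addnS ltnS leq_addr.
case dE: (drop a w) => [|l0 u].
  by have := size_drop a w; rewrite dE => /esym/eqP; rewrite subn_eq0 leqNgt lta.
have dS : drop a.+1 w = u by rewrite -addn1 addnC -drop_drop dE /= drop0.
rewrite (bigD1 l0) //= [X in _ + X]big1 ?addr0 => [|l ll0]; last first.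
  rewrite big1 // => b _; rewrite (_ : (Some _ == _) = false) ?andbF //.
  by apply: contraNF ll0 => /eqP[->].
rewrite (bigD1 (inord a.+1)) //= inordK // !eqxx /= dS.
rewrite big1 ?addr0 // => b; rewrite -val_eqE /= inordK // => /negPf->.
by [].
Qed.

(** On the line through [path_mx w], selfadjointness identifies the series of entry [(i, j)] with
    the adjoint of that of [(j, i)]; the corner entry in degree [size w] gives the coefficient at
    [w]. *)
Lemma coefs_of_matrix_selfadjoint :
  fps_rational Phi -> matrix_selfadjoint Phi -> Phi = fps_mxadj Phi.
Proof.
move=> rat sa; apply/funext=> w; apply/matrixP=> i j.
have [e de] : exists e : 'I_q -> 'I_q -> ratexpr C N, expr_for Phi e.
  have ex i' := fin_all_exists (rat i').
  by have [e he] := fin_all_exists ex; exists e.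
have [r rnz dr] := @ratexpr_line_defined _ _ _ (path_mx w) _
  (fun ij : 'I_q * 'I_q => e ij.1 ij.2) _ (fun ij => de ij.1 ij.2).
have skew l t : (l%:R *: path_mx w t)^t* = - (l%:R *: path_mx w t).
  by rewrite ctmxZ conjC_nat path_mx_skew scalerN.
have : eqmx_modX (size w).+1 (line_trunc (path_mx w) (size w).+1 (fun w => Phi w i j))
   (line_trunc (path_mx w) (size w).+1 (fps_adj (fun w => Phi w j i))).
  apply: (line_trunc_agree (de i j) (denotes_adj (de j i)) (@eqr_nat C) rnz).
  move=> l rl; have [s d] := subst_adj (skew l) (e j i).
  have dij a b := dr l%:R (a, b) rl.
  split; [exact: dij | by rewrite d; apply: dij |].
  have := sa _ (fun t => l%:R *: path_mx w t)
    (mxblock (fun i j => subst (fun t => l%:R *: path_mx w t) (e i j))) isT.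
  rewrite ctmx_mxblock s => saV.
  have ih t : iherm (l%:R *: path_mx w t) by apply/ihermP.
  have va : value_at Phi (fun t => l%:R *: path_mx w t)
      (mxblock (fun i j => subst (fun t => l%:R *: path_mx w t) (e i j))).
    by exists e.
  move/eq_mxblockP: (saV ih va); apply.
move=> /(_ ord0 ord_max (size w) (ltnSn _)).
by rewrite !path_mx_coef //= !add0n eqxx drop0 => ->; rewrite -fps_mxadjE.
Qed.

End Selfadjoint.
End Adjoint.

(** * Controllability of minimal nodes *)

Section Controllability.
Variable K : fieldType.

(** Take a subspace of maximal dimension contained in [P]: adjoining a vector of [P] to it cannot
    raise the rank. *)
Lemma linear_pred_mx n (P : 'rV[K]_n -> Prop) :
  P 0 -> (forall a x y, P x -> P y -> P (a *: x + y)) ->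
  exists U : 'M[K]_n, forall x, P x <-> (x <= U)%MS.
Proof.
move=> P0 PD.
pose Q r := `[< exists U : 'M[K]_n,
  (forall x : 'rV_n, (x <= U)%MS -> P x) /\ \rank U = r >].
have exQ : exists r, Q r.
  exists 0%N; apply/asboolP; exists 0; rewrite mxrank0; split=> // x.
  by rewrite submx0 => /eqP->.
have leQ r : Q r -> (r <= n)%N by case/asboolP=> U [_ <-]; apply: rank_leq_row.
case: (ex_maxnP exQ leQ) => r /asboolP[U [UP rU]] maxU.
exists U => x; split=> [Px|]; last exact: UP.
have UxP : Q (\rank (U + x)%MS).
  apply/asboolP; exists (U + x)%MS; split=> // y /sub_addsmxP[[u v] /= ->].
  rewrite addrC [v]mx11_scalar mul_scalar_mx; apply: PD => //.
  by apply: UP; apply: submxMl.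
have leU := addsmxSl U x.
have := mxrank_leqif_sup leU; case=> leR eqR.
apply: submx_trans (addsmxSr U x) _; rewrite -eqR rU.
by rewrite eqn_leq -{1}rU leR maxU.
Qed.

(** Dual form of controllability: the columns of all the [a i] span the whole space. *)
Definition separating (I : Type) n q (a : I -> 'M[K]_(n, q)) :=
  forall x : 'rV_n, (forall i, x *m a i = 0) -> x = 0.

Lemma separating_mx I m n q (a : I -> 'M[K]_(n, q)) (X : 'M_(m, n)) :
  separating a -> (forall i, X *m a i = 0) -> X = 0.
Proof.
move=> sa X0; apply/row_matrixP=> k; rewrite row0; apply: sa => i.
by rewrite -row_mul X0 row0.
Qed.

(* Otherwise the node could be compressed to its controllable subspaces. *)
Lemma minimal_controllable N q (Phi : fps 'M[K]_q N) (alpha : gr_node K N q) :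
  gr_minimal alpha Phi -> forall k, separating (gr_chain alpha k).
Proof.
case=> realA minA.
have /fin_all_exists[U UE] k : exists U : 'M[K]_(gr_dim alpha k), forall x : 'rV_ _,
    (forall w, x *m gr_chain alpha k w = 0) <-> (x <= U)%MS.
  apply: linear_pred_mx => [w|a x y x0 y0 w]; first by rewrite mul0mx.
  by rewrite mulmxDl -scalemxAl x0 y0 scaler0 addr0.
(* The columns of [Q k] form a basis of the space annihilated by [U k], which contains the columns
   of all chains; [L k] returns coordinates in it. *)
pose RB k := row_base (kermx (U k)^T).
pose Q k := (RB k)^T; pose L k := (pinvmx (RB k))^T.
have QL k w : Q k *m (L k *m gr_chain alpha k w) = gr_chain alpha k w.
  apply: trmx_inj; rewrite !trmx_mul !trmxK mulmxKpV // eq_row_base.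
  apply/sub_kermxP; rewrite -trmx_mul (_ : U k *m _ = 0) ?trmx0 //.
  apply/row_matrixP=> i; rewrite row_mul row0; move: w; apply/(UE k).
  exact: row_sub.
pose beta := GRNode
  (mxblock (fun i j => L i *m submxblock (gr_A alpha) i j *m Q j))
  (mxcol (fun i => L i *m submxcol (gr_B alpha) i))
  (mxrow (fun j => submxrow (gr_C alpha) j *m Q j)) (gr_D alpha).
have chainB k w : gr_chain beta k w = L k *m gr_chain alpha k w.
  elim: w k => [|j w IHw] k /=; first by rewrite mxcolK.
  by rewrite mxblockK IHw -!mulmxA QL.
have realB : gr_realization beta Phi.
  move=> w; rewrite -realA; case: w => //= j w.
  by rewrite mxrowK chainB -mulmxA QL.
(* The compressed block has size [gr_dim alpha k - \rank (U k)], so minimality forces [U k] to have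
   rank 0. *)
move=> k x /(UE k) xU; have := minA _ realB k; rewrite /= mxrank_ker mxrank_tr.
move=> le_dim; apply/eqP; rewrite -submx0; apply: submx_trans xU _.
rewrite submx0 -mxrank_eq0; have := rank_leq_row (U k).
move: le_dim; case: (\rank (U k)) => // r; case: (gr_dim alpha k) => // d.
by rewrite subSS ltnNge leq_subr.
Qed.

End Controllability.

(** * Intertwiners between separating families *)

Section SkewIntertwiner.
Variables (C : numClosedFieldType) (I : Type) (n q : nat).
Implicit Types a b : I -> 'M[C]_(n, q).

(** The rows [x] such that [x *m a w = y *m b w] for one [y] and all [w] form a subspace. It
    contains the rows of every [(b u)^t*], which span everything as [b] is separating; the unit rows
    then yield [Y]. *)
Lemma intertwiner_exists a b (c : I -> 'M_(q, n)) : separating b ->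
  (forall u w, (b u)^t* *m a w = c u *m b w) ->
  exists Y : 'M_n, forall w, a w = Y *m b w.
Proof.
move=> sb bac.
have [|x0 x y x1 x2|U UE] := @linear_pred_mx C n
  (fun x => exists y : 'rV_n, forall w, x *m a w = y *m b w).
- by exists 0 => w; rewrite !mul0mx.
- case: x1 x2 => [y1 h1] [y2 h2]; exists (x0 *: y1 + y2) => w.
  by rewrite !mulmxDl -!scalemxAl h1 h2.
have bU u : ((b u)^t* <= U)%MS.
  apply/row_subP=> i; apply/UE; exists (row i (c u)) => w.
  by rewrite -!row_mul bac.
have U1 : row_full U.
  rewrite /row_full -mxrank_tr; rewrite -[_ == _]/(row_free U^T) -kermx_eq0.
  set T := kermx _; apply/eqP/trmx_inj; rewrite trmx0; apply: ctmx_eq0.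
  apply: (separating_mx sb) => u.
  rewrite -[b u]ctmxK -ctmxM; have /submxP[D ->] := bU u.
  by rewrite -mulmxA -[U]trmxK -trmx_mul mulmx_ker trmx0 mulmx0 ctmx0.
have /fin_all_exists[y hy] i : exists y : 'rV_n, forall w, row i 1%:M *m a w = y *m b w.
  by apply/UE; apply: submx_full.
exists (\matrix_i y i) => w; apply/row_matrixP=> i.
by rewrite row_mul rowK -hy -row_mul mul1mx.
Qed.

(** Existence in both directions gives inverse matrices. [S] is skew-Hermitian because [S^t* + S],
    tested between [a u] and [a w], gives [(b u)^t* *m a w + (a u)^t* *m b w]. *)
Lemma skew_intertwiner a b : separating a -> separating b ->
  (forall u w, (a u)^t* *m b w = - ((b u)^t* *m a w)) ->
  exists S : 'M_n, [/\ S \in unitmx, S^t* = - S & forall w, S *m a w = b w].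
Proof.
move=> sa sb ab.
have [S bS] := @intertwiner_exists b a (fun u => - (b u)^t*) sa
  (fun u w => etrans (ab u w) (esym (mulNmx _ _))).
have [Y aY] := @intertwiner_exists a b (fun u => - (a u)^t*) sb
  (fun u w => esym (etrans (mulNmx _ _) (etrans (congr1 _ (ab u w)) (opprK _)))).
exists S; split=> [||w]; last by rewrite -bS.
  have : S *m Y = 1%:M.
    apply/eqP; rewrite -subr_eq0; apply/eqP; apply: (separating_mx sb) => w.
    by rewrite mulmxBl mul1mx -mulmxA -aY -bS subrr.
  by case/mulmx1_unit.
apply/eqP; rewrite -addr_eq0; apply/eqP; apply: (separating_mx sa) => w.
apply: ctmx_eq0; apply: (separating_mx sa) => u.
rewrite ctmxM ctmxD ctmxK mulmxDr mulmxDl.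
by rewrite -mulmxA -bS -ctmxM -bS ab addNr.
Qed.

End SkewIntertwiner.

(** * The adjoint node and the blockwise form of the matrix equations *)

Section AdjointNode.
Variables (C : numClosedFieldType) (N q : nat) (alpha : gr_node C N q).

Local Notation A := (gr_A alpha).
Local Notation B := (gr_B alpha).
Local Notation Aij := (submxblock A).

Definition gr_adj : gr_node C N q :=
  GRNode (- A^t*) ((gr_C alpha)^t*) (- B^t*) ((gr_D alpha)^t*).

Lemma gr_adj_A i j : submxblock (gr_A gr_adj) i j = - (Aij j i)^t*.
Proof. by apply/matrixP=> a b; rewrite !mxE. Qed.

Lemma gr_adj_B i : submxcol (gr_B gr_adj) i = (submxrow (gr_C alpha) i)^t*.
Proof. by apply/matrixP=> a b; rewrite !mxE. Qed.

Lemma gr_adj_C i : submxrow (gr_C gr_adj) i = - (submxcol B i)^t*.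
Proof. by apply/matrixP=> a b; rewrite !mxE. Qed.

(** Factorization of the Hankel matrix: the adjoint of a chain of [gr_adj] is, up to sign, an
    observability block of [alpha]. Each induction step moves the first letter of [u] across the
    product. *)
Lemma gr_adj_chain k u w :
  (gr_chain gr_adj k u)^t* *m gr_chain alpha k w
    = (-1) ^+ size u *: gr_transfer alpha (rev u ++ k :: w).
Proof.
elim: u k w => [|j u IHu] k w.
  by rewrite expr0 scale1r [gr_chain gr_adj _ _]gr_adj_B ctmxK.
rewrite [gr_chain gr_adj _ _]/= gr_adj_A mulNmx ctmxN ctmxM ctmxK mulNmx.
rewrite -mulmxA -[Aij _ _ *m _]/(gr_chain alpha j (k :: w)) IHu.
by rewrite exprS mulN1r scaleNr rev_cons cat_rcons.
Qed.

Lemma gr_transfer_adj : gr_transfer gr_adj = fps_mxadj (gr_transfer alpha).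
Proof.
apply/funext=> -[|j u]; rewrite /fps_mxadj; first by rewrite expr0 scale1r.
rewrite [LHS]/= gr_adj_C mulNmx -[_ *m _]ctmxK ctmxM ctmxK.
have /= -> := gr_adj_chain j u [::].
rewrite rev_cons -cats1 ctmxZ rmorphXn rmorphN rmorph1.
by rewrite exprS mulN1r scaleNr.
Qed.

Section Blocks.
Variable H : forall k, 'M[C]_(gr_dim alpha k).

Lemma lyapunov_blocks :
  A^t* *m mxdiag H + mxdiag H *m A = 0 <->
  forall i j, submxblock (gr_A gr_adj) i j *m H j = H i *m Aij i j.
Proof.
rewrite -{2}(submxblockK A) mul_mxdiag_mxblock.
rewrite -(submxblockK (A^t*)) mul_mxblock_mxdiag -mxblockD.
rewrite -[X in _ = X](@mxblock0 C).
have E i j : submxblock (gr_A gr_adj) i j = - submxblock (A^t*) i j.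
  exact: submxblockN.
split=> [/eq_mxblockP h i j|h].
  by rewrite E mulNmx; apply/esym/eqP; rewrite -addr_eq0 addrC h.
apply/eq_mxblockP=> i j; rewrite -h E mulNmx; exact: subrr.
Qed.

(** The factor [- 'i] comes from [S = - 'i *: H], which turns the equation into [C = - B^* S]. *)
Lemma output_blocks :
  gr_C alpha = 'i *: (B^t* *m mxdiag H) <->
  forall j, submxrow (gr_C alpha) j = - 'i *: (submxrow (gr_C gr_adj) j *m H j).
Proof.
rewrite -{1}(submxrowK (gr_C alpha)) -(submxrowK (B^t*)) mul_mxrow_mxdiag.
have E j : submxrow (gr_C gr_adj) j = - submxrow (B^t*) j by exact: submxrowN.
have F j : - 'i *: (submxrow (gr_C gr_adj) j *m H j) = 'i *: (submxrow (B^t*) j *m H j).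
  by rewrite E mulNmx scalerN scaleNr opprK.
rewrite -[X in X *: _]/('i : C) -mul_scalar_mx mul_mxrow.
split=> [/eq_mxrowP h j|h]; first by rewrite F h mul_scalar_mx.
by apply/eq_mxrowP=> j; rewrite h F mul_scalar_mx.
Qed.

Lemma hermitian_blocks :
  mxdiag H \is hermsymmx <-> forall k, (H k)^t* = H k.
Proof.
have E : (mxdiag H)^t* = mxdiag (fun k => (H k)^t*).
  rewrite /mxdiag ctmx_mxblock; apply/eq_mxblock=> i j; rewrite eq_sym.
  by case: eqVneq => [->|_]; rewrite ?conform_mx_id ?ctmx0.
split=> [/is_hermitianmxP|h]; first by rewrite expr0 scale1r E => /eq_mxdiagP.
by apply/is_hermitianmxP; rewrite expr0 scale1r E; apply/eq_mxdiagP.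
Qed.

Lemma unitmx_blocks : (forall k, H k \in unitmx) -> mxdiag H \in unitmx.
Proof.
move=> Hu; have : mxdiag H *m mxdiag (fun k => invmx (H k)) = 1%:M.
  rewrite mul_mxdiag_mxblock -mxdiagZ; apply/eq_mxblockP=> i j.
  by case: eqVneq => [->|_]; rewrite ?mulmx0 // !conform_mx_id mulmxV.
by case/mulmx1_unit.
Qed.

End Blocks.
End AdjointNode.

(** * Similarity of a minimal node with its adjoint *)

Section Similarity.
Variables (C : numClosedFieldType) (N q : nat) (Phi : fps 'M[C]_q N).
Variable alpha : gr_node C N q.

Definition adj_similarity (S : forall k, 'M[C]_(gr_dim alpha k)) :=
  forall k w, S k *m gr_chain alpha k w = gr_chain (gr_adj alpha) k w.

Lemma minimal_adj_similarity : gr_minimal alpha Phi -> Phi = fps_mxadj Phi ->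
  exists S : forall k, 'M[C]_(gr_dim alpha k),
    adj_similarity S /\ forall k, S k \in unitmx /\ (S k)^t* = - S k.
Proof.
move=> minA PhiE; have [/funext realA min] := minA.
have minA' : gr_minimal (gr_adj alpha) Phi.
  by split=> // w; rewrite gr_transfer_adj realA -PhiE.
have ctrl := minimal_controllable minA.
have ctrl' := minimal_controllable minA'.
(* Up to sign and adjoint, both products are coefficients of [Phi], at a word and at its reverse;
   the middle letter [k] accounts for the minus sign. *)
have skew k u w : (gr_chain alpha k u)^t* *m gr_chain (gr_adj alpha) k w
    = - ((gr_chain (gr_adj alpha) k u)^t* *m gr_chain alpha k w).
  rewrite -[LHS]ctmxK ctmxM ctmxK !gr_adj_chain realA {2}PhiE /fps_mxadj.
  rewrite rev_cat rev_cons revK cat_rcons size_cat size_rev /=.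
  rewrite ctmxZ scalerA -scaleNr rmorphXn rmorphN rmorph1; congr (_ *: _).
  by rewrite addnS exprS exprD mulN1r mulrN opprK mulrA -expr2 sqrr_sign mul1r.
have /fin_all_exists[S hS] k := skew_intertwiner (ctrl k) (ctrl' k) (skew k).
exists S; split=> [k w|k]; by have [] := hS k.
Qed.

Lemma adj_similarity_matrices S : gr_minimal alpha Phi -> adj_similarity S ->
  forall i j, submxblock (gr_A (gr_adj alpha)) i j *m S j
              = S i *m submxblock (gr_A alpha) i j.
Proof.
move=> minA simS i j; apply/eqP; rewrite -subr_eq0; apply/eqP.
apply: (separating_mx (minimal_controllable minA (k := j))) => w.
rewrite mulmxBl -!mulmxA simS -[_ *m gr_chain alpha j w]/(gr_chain alpha i (j :: w)).
by rewrite simS subrr.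
Qed.

(** The similarity starts from [S B = C^*], the adjoint of the output equation for skew-Hermitian
    [S], and propagates along words by the intertwining relation; the two nodes then have equal
    transfer functions. *)
Lemma adj_similarity_coefs S : gr_realization alpha Phi ->
  gr_D alpha = (gr_D alpha)^t* ->
  (forall i j, submxblock (gr_A (gr_adj alpha)) i j *m S j
               = S i *m submxblock (gr_A alpha) i j) ->
  (forall j, submxrow (gr_C alpha) j = submxrow (gr_C (gr_adj alpha)) j *m S j) ->
  (forall k, (S k)^t* = - S k) ->
  Phi = fps_mxadj Phi.
Proof.
move=> /funext<- DE AE CE SE; rewrite -gr_transfer_adj.
have simS : adj_similarity S.
  move=> k w; elim: w k => [|j w IHw] k /=; last by rewrite -IHw !mulmxA AE.
  by rewrite gr_adj_B CE ctmxM gr_adj_C ctmxN ctmxK SE mulmxN mulNmx opprK.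
apply/funext=> -[|j w]; first exact: DE.
by rewrite /= CE -mulmxA simS.
Qed.

End Similarity.

(** * Passage between the skew-Hermitian similarity and the Hermitian matrix [H] *)

Theorem theorem7p1 (R : realType) (N q : nat)
    (Phi : fps 'M[R[i]]_q N) (alpha : gr_node R[i] N q)
    (Phi_rational : fps_rational Phi) (alpha_minimal : gr_minimal alpha Phi) :
  matrix_selfadjoint Phi <->
  gr_D alpha = (gr_D alpha)^t* /\
  (exists Hk : forall k : 'I_N, 'M[R[i]]_(gr_dim alpha k),
     let H := mxdiag Hk in
     [/\ H \in unitmx, H \is hermsymmx,
         (gr_A alpha)^t* *m H + H *m gr_A alpha = 0 &
         gr_C alpha = 'i *: ((gr_B alpha)^t* *m H)]).
Proof.
have [realA _] := alpha_minimal.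
split=> [sa|[DE [H [_ /hermitian_blocks Hh /lyapunov_blocks HA /output_blocks HC]]]].
  have PhiE := coefs_of_matrix_selfadjoint Phi_rational sa.
  split; first by rewrite [LHS](realA [::]) PhiE /fps_mxadj expr0 scale1r -realA.
  have [S [simS hS]] := minimal_adj_similarity alpha_minimal PhiE.
  exists (fun k => 'i *: S k); split.
  - by apply: unitmx_blocks => k; rewrite unitmxZ ?unitfE ?neq0Ci //; case: (hS k).
  - apply/hermitian_blocks=> k; have [_ Sk] := hS k.
    by rewrite ctmxZ Sk conjCi scalerN scaleNr opprK.
  - apply/lyapunov_blocks=> i j.
    rewrite -scalemxAr -scalemxAl.
    by rewrite (adj_similarity_matrices alpha_minimal simS).
  - apply/output_blocks=> j; have [_ Sj] := hS j.
    rewrite -scalemxAr scalerA mulNr -expr2 sqrCi opprK scale1r.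
    (* At the empty word the similarity reads [S B = C^*]; its adjoint is the output equation. *)
    have /(congr1 (fun M => - M^t*)) := simS j [::].
    rewrite [gr_chain (gr_adj _) _ _]gr_adj_B ctmxK ctmxM Sj mulmxN opprK /= => E.
    by rewrite gr_adj_C mulNmx E opprK.
apply: matrix_selfadjoint_of_coefs.
(* This [S] inverts the substitution [H = i S]. *)
apply: (adj_similarity_coefs (S := fun k => - 'i *: H k)) realA DE _ _ _.
- by move=> i j; rewrite -scalemxAr -scalemxAl HA.
- by move=> j; rewrite HC scalemxAr.
by move=> k; rewrite ctmxZ Hh rmorphN /= conjCi opprK scaleNr opprK.
Qed.
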